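(* Assume a universal $L$-operator $\mathcal L^+(u)$ of $\mathcal U=U_{t_1,t_2,p}(\mathfrak{gl}_{1,tor})$ with components $\mathcal L^+_{\mu\nu}(u)$ acting on $\mathcal F^{(0,-1)}_\bullet$ and $\mathcal F^{(1,N)}_\bullet$ as described in the context, and let $\Delta$ be the standard comultiplication, $\Delta(\mathcal L^+_{\mu\nu}(u))=\sum_\lambda\mathcal L^+_{\mu\lambda}(u\gamma^{(2)})\,\widetilde\otimes\,\mathcal L^+_{\lambda\nu}(u)$. Assume that the $R$-matrices $R^+_{T^{1/2}}$, $R^{+*}_{T^{1/2}}$ are invariant under the shift of the dynamical parameter by $\hbar^{-2}$ and depend on $u,v$ only through $u/v$. Suppose that for all partitions $\mu,\nu,\mu'',\nu''$ and generic $u,v$ $$\Phi_\nu(\hbar^{1/2}v)L^+_{\mu\mu''}(u)=\sum_{\mu',\nu'}R^+_{T^{1/2}}(u,v;\mathfrak z)^{\mu'\nu'}_{\mu\nu}L^+_{\mu'\mu''}(u)\Phi_{\nu'}(\hbar^{1/2}v),\qquad L^+_{\mu\mu''}(u)\Psi^*_{\nu''}(v)=\sum_{\mu',\nu'}\Psi^*_{\nu'}(v)L^+_{\mu\mu'}(u)R^{+*}_{T^{1/2}}(u,v;\mathfrak z^* )^{\mu''\nu''}_{\mu'\nu'}.$$ These are exactly the intertwining relations with respect to $\Delta$ for the type I vertex operator $\Phi(v)$ and the type II dual vertex operator $\Psi^*(v)$, i.e. $$\Phi(v)\,\mathcal L^+_{\mu\nu}(u)=\Delta(\mathcal L^+_{\mu\nu}(u))\,\Phi(v),$$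 $$\mathcal L^+_{\mu\nu}(u)\,\Psi^*(v)(\xi\,\widetilde\otimes\,|\lambda\rangle_v)=\Psi^*(v)\,\Delta(\mathcal L^+_{\mu\nu}(u))\,(\xi\,\widetilde\otimes\,|\lambda\rangle_v)$$ for all $\xi\in\mathcal F^{(1,N)}_\bullet$ and $|\lambda\rangle_v\in\mathcal F^{(0,-1)}_v$.
   Context: Parameters: $t_1,t_2,p$ generic, $\hbar=t_1t_2$. The dynamical parameters are operators $\mathfrak z^*=\hbar^P$, $\mathfrak z=\hbar^{P-c}$, so $\mathfrak z^*=\mathfrak z\hbar^{c}$, with $[P,Q]=1$, $[c,\Lambda_0]=1$ and the other commutators among $P,Q,c,\Lambda_0$ zero. $\mathcal U=U_{t_1,t_2,p}(\mathfrak{gl}_{1,tor})$ is the elliptic quantum toroidal algebra; it has a central element $\gamma$, and $p^*=p\gamma^{-2}$. Two kinds of modules are used. (i) $\mathcal F^{(1,N)}_w$ ($N\in\mathbb Z$, $w\in\mathbb C^\times$): level-$(1,N)$ Fock modules, on which $\gamma=\hbar^{1/2}$, $c=N$, $p^*=p\hbar^{-1}$. (ii) $\mathcal F^{(0,-1)}_v$: the level-$(0,-1)$ module with basis $|\lambda\rangle_v$ indexed by partitions $\lambda$, on which $\gamma=1$, $c=-1$, and $e^{\pm Q}|\lambda\rangle_v=|\lambda\rangle_v$. $\widetilde\otimes$ is the tensor product with the extra relation $F(\mathfrak z^*,p^* )a\,\widetilde\otimes\,b=a\,\widetilde\otimes\,F(\mathfrak z,p)b$ for meromorphic $F$; $X^{(2)}$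 denotes $X$ acting in the second tensor factor. $R^+_{T^{1/2}}(u,v;\mathfrak z)$ is a matrix with entries $R^+_{T^{1/2}}(u,v;\mathfrak z)^{\mu'\nu'}_{\mu\nu}$ (nonzero only if $|\mu|+|\nu|=|\mu'|+|\nu'|$), meromorphic in $u/v,\mathfrak z$ and depending on $p$ (a scalar multiple of the transition matrix between elliptic stable envelopes of $\mathcal M(n,2)$, the moduli space of framed rank 2 torsion free sheaves on $\mathbb P^2$ with $c_2=n$, for the two chambers), and $R^{+*}_{T^{1/2}}=R^+_{T^{1/2}}|_{p\to p^*}$. The standing assumption is $R^+_{T^{1/2}}(u,v;\mathfrak z\hbar^{-2})=R^+_{T^{1/2}}(u,v;\mathfrak z)$ (and the same for $R^{+*}_{T^{1/2}}$), and $R^+_{T^{1/2}}(au,av;\mathfrak z)=R^+_{T^{1/2}}(u,v;\mathfrak z)$ for $a\in\mathbb C^\times$. Vertex operators: $\Phi(v):\mathcal F^{(1,N)}_w\to\mathcal F^{(0,-1)}_v\widetilde\otimes\mathcal F^{(1,N+1)}_{-w/v}$, $\Phi(v)\xi=\sum_\lambda|\lambda\rangle_v\widetilde\otimes\Phi_\lambda(v)\xi$; $\Psi^*(v):\mathcal F^{(1,N)}_w\widetilde\otimes\mathcal F^{(0,-1)}_v\to\mathcal F^{(1,N-1)}_{-wv}$, $\Psi^*(v)(\xi\widetilde\otimes|\lambda\rangle_v)=\Psi^*_\lambda(v)\xi$. Their components are screened vertex operators satisfying $\mathfrak z\Phi_\lambda=\hbar^{-1}\Phi_\lambda\mathfrak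 z$, $[\mathfrak z^*,\Phi_\lambda]=0$, $\Psi^*_\lambda\mathfrak z^*=\hbar\mathfrak z^*\Psi^*_\lambda$, $[\mathfrak z,\Psi^*_\lambda]=0$. $L$-operator on $\mathcal F^{(1,N)}_\bullet$: $L^+_{\mu\nu}(u)=(\hbar;t_1,t_2)_\infty\Psi^*_\nu(u)\Phi_\mu(\hbar^{1/2}u)$, where $(z;t_1,t_2)_\infty=\prod_{m_1,m_2\ge0}(1-zt_1^{m_1}t_2^{m_2})$. Universal $L$-operator (assumed): $\mathcal L^+(u)\in\mathrm{End}(\mathcal F^{(0,-1)}_\bullet)\widetilde\otimes\,\mathcal U$ with components $\mathcal L^+_{\mu\nu}(u)=\mathcal L^+_{\mu\nu}(u;\mathfrak z^* )e^{-Q}\in\mathcal U$, satisfying $\sum R^+_{T^{1/2}}(u,v;\mathfrak z)^{\mu'\nu'}_{\mu\nu}\mathcal L^+_{\mu'\mu''}(u)\mathcal L^+_{\nu'\nu''}(v)=\sum\mathcal L^+_{\nu\nu'}(v)\mathcal L^+_{\mu\mu'}(u)R^{+*}_{T^{1/2}}(u,v;\mathfrak z^* )^{\mu''\nu''}_{\mu'\nu'}$ (sums over $\mu',\nu'$), and acting by $\mathcal L^+_{\mu\nu}(u)|\lambda\rangle_v=\sum_{\lambda'}R^+_{T^{1/2}}(u,v;\mathfrak z^* )^{\nu\lambda}_{\mu\lambda'}|\lambda'\rangle_v$ on $\mathcal F^{(0,-1)}_v$ and $\mathcal L^+_{\mu\nu}(u)\xi=L^+_{\mu\nu}(u)\xi$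 on $\mathcal F^{(1,N)}_\bullet$. Standard comultiplication: $\Delta(\mathcal L^+_{\mu\nu}(u))=\sum_\lambda\mathcal L^+_{\mu\lambda}(u\gamma^{(2)})\widetilde\otimes\mathcal L^+_{\lambda\nu}(u)$, $\Delta(g(\mathfrak z,p))=g(\mathfrak z,p)\widetilde\otimes1$, $\Delta(g(\mathfrak z^*,p^* ))=1\widetilde\otimes g(\mathfrak z^*,p^* )$, $\Delta(\gamma^{1/2})=\gamma^{1/2}\widetilde\otimes\gamma^{1/2}$. *)

(* Defs.v *)
From HB Require Import structures.
From mathcomp Require Import all_boot all_order all_algebra ring_quotient.
From mathcomp Require Import all_classical all_reals all_analysis.
From mathcomp Require Import complex.
Set Implicit Arguments.
Unset Strict Implicit.
Unset Printing Implicit Defensive.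
Import Order.TTheory GRing.Theory Num.Theory numFieldNormedType.Exports.
Local Open Scope classical_set_scope.
Local Open Scope ring_scope.
Local Open Scope quotient_scope.

Section Generically.
Variable T : topologicalType.
Implicit Types D A B : set T.

(* A holds on D off a nowhere dense closed subset *)
Definition generically D A := D `<=` closure A°.

Lemma generically_sub D A B : A `<=` B -> generically D A -> generically D B.
Proof.
move=> AB DA; apply: (subset_trans DA); apply: closureS.
exact: interiorS.
Qed.

Lemma generically_subl D1 D2 A :
  D1 `<=` D2 -> generically D2 A -> generically D1 A.
Proof. by move=> D12 D2A; exact: (subset_trans D12 D2A). Qed.

Lemma generically_and D A B : open D ->
  generically D A -> generically D B -> generically D (A `&` B).
Proof.
move=> oD DA DB x Dx O Ox.
have [t [At [Ot Dt]]] : A° `&` (O° `&` D) !=set0.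
  apply: (DA x Dx); apply: filterI; first exact: nbhs_interior.
  exact: open_nbhs_nbhs.
have [s [Bs [As Os]]] : B° `&` (A° `&` O°) !=set0.
  apply: (DB t Dt); apply: filterI.
    by apply: open_nbhs_nbhs; split=> //; exact: open_interior.
  by apply: open_nbhs_nbhs; split=> //; exact: open_interior.
exists s; split; last exact: (interior_subset Os).
by rewrite interiorI.
Qed.
End Generically.

Section Meromorphic.
Variables (K : numFieldType) (V : normedModType K).

(* f is locally a quotient of holomorphic functions; at the zeros of the
   denominator the value of f is irrelevant. *)
Definition meromorphic_on (D : set V) (f : V -> K) := forall x, D x ->
  exists W : set V, [/\ open W, W x & exists g h : V -> K,
    [/\ forall y, W y -> differentiable g y,
        forall y, W y -> differentiable h y,
        generically W [set y | h y != 0]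
      & forall y, W y -> h y != 0 -> f y = g y / h y]].

Lemma meromorphic_onW D1 D2 f :
  D1 `<=` D2 -> meromorphic_on D2 f -> meromorphic_on D1 f.
Proof. by move=> D12 f2 x /D12; exact: f2. Qed.

Lemma meromorphic_on_differentiable D f : open D ->
  (forall y, D y -> differentiable f y) -> meromorphic_on D f.
Proof.
move=> oD df x Dx; exists D; split=> //; exists f, (cst 1); split=> //.
- rewrite /generically (_ : [set _ | _] = setT) ?interiorT ?closureT //.
  by apply/seteqP; split=> // y _ /=; exact: oner_neq0.
- by move=> y _ _; rewrite /cst divr1.
Qed.

Lemma meromorphic_onB D f1 f2 : meromorphic_on D f1 -> meromorphic_on D f2 ->
  meromorphic_on D (f1 - f2).
Proof.
move=> m1 m2 x Dx.
have [W1 [oW1 W1x [g1 [h1 [dg1 dh1 ge1 e1]]]]] := m1 x Dx.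
have [W2 [oW2 W2x [g2 [h2 [dg2 dh2 ge2 e2]]]]] := m2 x Dx.
exists (W1 `&` W2); split=> //; first exact: openI.
exists (g1 * h2 - g2 * h1), (h1 * h2); split.
- move=> y [W1y W2y]; apply: differentiableB; apply: differentiableM; auto.
- by move=> y [W1y W2y]; apply: differentiableM; auto.
- apply: (@generically_sub _ _ ([set y | h1 y != 0] `&` [set y | h2 y != 0])).
    by move=> y [/= n1 n2]; rewrite mulf_neq0.
  apply: generically_and; first exact: openI.
  + exact: (generically_subl (@subIsetl _ _ _) ge1).
  + exact: (generically_subl (@subIsetr _ _ _) ge2).
- move=> y [W1y W2y] /=; rewrite mulf_eq0 negb_or => /andP[n1 n2].
  rewrite !fctE e1 // e2 // -mulNr addf_div // mulNr; congr (_ / _).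
Qed.

Lemma meromorphic_onM D f1 f2 : meromorphic_on D f1 -> meromorphic_on D f2 ->
  meromorphic_on D (f1 * f2).
Proof.
move=> m1 m2 x Dx.
have [W1 [oW1 W1x [g1 [h1 [dg1 dh1 ge1 e1]]]]] := m1 x Dx.
have [W2 [oW2 W2x [g2 [h2 [dg2 dh2 ge2 e2]]]]] := m2 x Dx.
exists (W1 `&` W2); split=> //; first exact: openI.
exists (g1 * g2), (h1 * h2); split.
- by move=> y [W1y W2y]; apply: differentiableM; auto.
- by move=> y [W1y W2y]; apply: differentiableM; auto.
- apply: (@generically_sub _ _ ([set y | h1 y != 0] `&` [set y | h2 y != 0])).
    by move=> y [/= n1 n2]; rewrite mulf_neq0.
  apply: generically_and; first exact: openI.
  + exact: (generically_subl (@subIsetl _ _ _) ge1).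
  + exact: (generically_subl (@subIsetr _ _ _) ge2).
- move=> y [W1y W2y] /=; rewrite mulf_eq0 negb_or => /andP[n1 n2].
  by rewrite !fctE e1 // e2 // mulf_div.
Qed.
End Meromorphic.

Section Germs.
Variable K : numFieldType.
Local Notation KK := (K * K)%type.
Implicit Types (f g : KK -> K) (a b e : K).

(* Functions of (z, p) are meromorphic for z in C^* and p in a punctured disc
   around 0; the radius e is not fixed, so that F(z, p) |-> F(a z, b p) is an
   operation on germs at p = 0. *)
Definition dyn_domain e : set KK :=
  [set x | x.1 != 0 /\ 0 < `|x.2| < e].

Lemma dyn_domain_open e : open (dyn_domain e).
Proof.
have -> : dyn_domain e =
  (fst @^-1` [set z : K | z != 0]) `&`
  (snd @^-1` ([set p : K | p != 0] `&` [set p : K | `|p| < e])).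
  apply/seteqP; split=> x /=.
    by move=> [z0 /andP[p0 pe]]; rewrite -(normr_gt0 x.2).
  by move=> [z0 [p0 pe]]; split=> //; apply/andP; split=> //; rewrite normr_gt0.
have o0 : open [set z : K | z != 0].
  rewrite (_ : [set _ | _] = ~` [set 0]); last first.
    by apply/seteqP; split=> z /=; [move=> /eqP | move=> z0; apply/eqP].
  by apply: closed_openC; apply: accessible_closed_set1; exact: hausdorff_accessible.
apply: openI.
  by apply: open_comp => // x _; exact: cvg_fst.
apply: open_comp => [x _|]; first exact: cvg_snd.
apply: openI => //.
rewrite (_ : [set _ | _] = ball (0 : K^o) e); first exact: ball_open.
by apply/seteqP; split=> z; rewrite -ball_normE /ball_ /= sub0r normrN.
Qed.


Lemma dyn_domainW e1 e2 : e1 <= e2 -> dyn_domain e1 `<=` dyn_domain e2.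
Proof. by move=> e12 x [x1 /andP[x2 xe]]; split=> //; rewrite x2 (lt_le_trans xe). Qed.

Lemma dyn_domain_nonempty e : 0 < e -> dyn_domain e !=set0.
Proof.
move=> e0; exists (1, e / 2); split=> /=; first exact: oner_neq0.
have e20 : 0 < e / 2 by rewrite divr_gt0.
by rewrite gtr0_norm // e20 gtr_pMr // invf_lt1 // ltr1n.
Qed.

Definition meromorphic_germ (f : KK -> K) :=
  exists2 e, 0 < e & meromorphic_on (dyn_domain e) f.

Definition negligible_germ (f : KK -> K) :=
  exists2 e, 0 < e & generically (dyn_domain e) [set x | f x = 0].

Lemma common_radius e1 e2 : 0 < e1 -> 0 < e2 ->
  exists e, [/\ 0 < e, e <= e1 & e <= e2].
Proof.
move=> e10 e20; have /real_leP := gtr0_real e10.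
move/(_ e2 (gtr0_real e20)); case=> h; first by exists e1.
by exists e2; split=> //; exact: ltW.
Qed.

Definition mero_pred : {pred KK -> K} := fun f => `[< meromorphic_germ f >].

Lemma mero_pred_subring : subring_closed mero_pred.
Proof.
split.
- apply/asboolP; exists 1 => //; apply: meromorphic_on_differentiable.
    exact: dyn_domain_open.
  by move=> y _; exact: differentiable_cst.
- move=> f g /asboolP[e1 e10 m1] /asboolP[e2 e20 m2]; apply/asboolP.
  have [e [e0 le1 le2]] := common_radius e10 e20; exists e => //.
  apply: meromorphic_onB.
  + exact: meromorphic_onW (dyn_domainW le1) m1.
  + exact: meromorphic_onW (dyn_domainW le2) m2.
- move=> f g /asboolP[e1 e10 m1] /asboolP[e2 e20 m2]; apply/asboolP.
  have [e [e0 le1 le2]] := common_radius e10 e20; exists e => //.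
  apply: meromorphic_onM.
  + exact: meromorphic_onW (dyn_domainW le1) m1.
  + exact: meromorphic_onW (dyn_domainW le2) m2.
Qed.

HB.instance Definition _ :=
  GRing.isSubringClosed.Build (KK -> K) mero_pred mero_pred_subring.

Record mero_rep := MeroRep { mero_fun :> KK -> K; _ : mero_fun \in mero_pred }.

HB.instance Definition _ := [isSub for mero_fun].
HB.instance Definition _ := [Choice of mero_rep by <:].
HB.instance Definition _ := [SubChoice_isSubComNzRing of mero_rep by <:].

Definition mero_null : {pred mero_rep} :=
  fun f : mero_rep => `[< negligible_germ (mero_fun f) >].

Lemma mero_null_ideal : idealr_closed mero_null.
Proof.
split.
- apply/asboolP; exists 1 => // x Dx; apply: subset_closure.
  by rewrite (_ : [set _ | _] = setT) ?interiorT //; apply/seteqP; split.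
- apply/asboolP => -[e e0 h]; have [x Dx] := dyn_domain_nonempty e0.
  have := h x Dx; rewrite (_ : [set _ | _] = set0) ?interior0 ?closure0 //.
  by apply/seteqP; split=> // y /= /eqP; rewrite oner_eq0.
- move=> a u v /asboolP[e1 e10 m1] /asboolP[e2 e20 m2]; apply/asboolP.
  have [e [e0 le1 le2]] := common_radius e10 e20; exists e => //.
  apply: (@generically_sub _ _ ([set x | u x = 0] `&` [set x | v x = 0])).
    by move=> x [/= u0 v0]; rewrite !fctE u0 v0 mulr0 addr0.
  apply: generically_and; first exact: dyn_domain_open.
  + exact: generically_subl (dyn_domainW le1) m1.
  + exact: generically_subl (dyn_domainW le2) m2.
Qed.

HB.instance Definition _ := isIdealr.Build mero_rep mero_null mero_null_ideal.

(* meromorphic germs up to equality off a nowhere dense set *)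
Definition mero : comNzRingType := {ideal_quot mero_null}.

(* the class of f, or 0 if f is not meromorphic *)
Definition mero_of (f : KK -> K) : mero :=
  \pi_{ideal_quot mero_null} (insubd 0 f).

Lemma mero_ofP (F : mero) : exists2 f, meromorphic_germ f & F = mero_of f.
Proof.
have := reprK F; move: (repr F) => [f fm] <-; exists f; first exact/asboolP.
rewrite /mero_of; congr (\pi _); apply: val_inj => /=.
by rewrite insubdK.
Qed.

Lemma mero_of_eqP f g : meromorphic_germ f -> meromorphic_germ g ->
  mero_of f = mero_of g <-> negligible_germ (f - g).
Proof.
move=> fm gm; rewrite /mero_of.
have vB : mero_fun (insubd 0 f - insubd 0 g : mero_rep) = f - g.
  by rewrite /= (insubdK _ (_ : f \in mero_pred)) ?(insubdK _ (_ : g \in mero_pred)) //;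
    apply/asboolP.
split=> [/eqP|fg].
  by rewrite -Quotient.idealrBE => /asboolP; rewrite vB.
by apply/eqP; rewrite -Quotient.idealrBE; apply/asboolP; rewrite vB.
Qed.

(* F(z, p) |-> F(a z, b p), for a, b != 0 *)
Definition rescale a b (F : mero) : mero :=
  mero_of (fun x => (repr F : mero_rep) (a * x.1, b * x.2)).

Let sc a b (x : KK) : KK := (a * x.1, b * x.2).

Lemma sc_differentiable a b x : differentiable (sc a b) x.
Proof.
have fst_diff : differentiable (fst : KK -> K) x.
  by apply: linear_differentiable => y; exact: cvg_fst.
have snd_diff : differentiable (snd : KK -> K) x.
  by apply: linear_differentiable => y; exact: cvg_snd.
apply: differentiable_pair.
  exact: (differentiableM (differentiable_cst a x) fst_diff).
exact: (differentiableM (differentiable_cst b x) snd_diff).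
Qed.

Lemma sc_cont a b : continuous (sc a b).
Proof. by move=> x; apply: differentiable_continuous; exact: sc_differentiable. Qed.

Lemma sc_domain a b e x : a != 0 -> b != 0 ->
  dyn_domain e (sc a b x) <-> dyn_domain (e / `|b|) x.
Proof.
move=> a0 b0; rewrite /dyn_domain /= mulf_eq0 negb_or a0 normrM.
by rewrite pmulr_rgt0 ?normr_gt0 // ltr_pdivlMr ?normr_gt0 // mulrC.
Qed.

Lemma scK a b : a != 0 -> b != 0 -> cancel (sc a b) (sc a^-1 b^-1).
Proof. by move=> a0 b0 [x y]; rewrite /sc /= !mulKf. Qed.

Lemma generically_sc a b D A : a != 0 -> b != 0 -> generically D A ->
  generically (sc a b @^-1` D) (sc a b @^-1` A).
Proof.
move=> a0 b0 DA x Dx O Ox.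
have Os : nbhs (sc a b x) (sc a^-1 b^-1 @^-1` O).
  by apply: sc_cont; rewrite scK.
have [t [At Ot]] := DA _ Dx _ Os.
exists (sc a^-1 b^-1 t); split=> //.
have scKV : sc a b (sc a^-1 b^-1 t) = t.
  by rewrite -{1}(invrK a) -{1}(invrK b) scK // invr_eq0.
by apply: sc_cont; rewrite scKV.
Qed.

Lemma meromorphic_germ_sc a b f : a != 0 -> b != 0 ->
  meromorphic_germ f -> meromorphic_germ (f \o sc a b).
Proof.
move=> a0 b0 [e e0 fm]; exists (e / `|b|); first by rewrite divr_gt0 ?normr_gt0.
move=> x /(sc_domain _ _ a0 b0)/fm[W [oW Wx [g [h [dg dh gW eq]]]]].
exists (sc a b @^-1` W); split=> //.
  by apply: open_comp => // y _; exact: sc_cont.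
exists (g \o sc a b), (h \o sc a b); split.
- move=> y Wy; apply: differentiable_comp; [exact: sc_differentiable|exact: dg].
- move=> y Wy; apply: differentiable_comp; [exact: sc_differentiable|exact: dh].
- exact: (generically_sc a0 b0 gW).
- by move=> y Wy; exact: eq.
Qed.

Lemma negligible_germ_sc a b f : a != 0 -> b != 0 ->
  negligible_germ f -> negligible_germ (f \o sc a b).
Proof.
move=> a0 b0 [e e0 fm]; exists (e / `|b|); first by rewrite divr_gt0 ?normr_gt0.
apply: generically_subl (generically_sc a0 b0 fm).
by move=> x /(sc_domain _ _ a0 b0).
Qed.

Lemma rescale_mero_of a b f : a != 0 -> b != 0 -> meromorphic_germ f ->
  rescale a b (mero_of f) = mero_of (fun x => f (a * x.1, b * x.2)).
Proof.
move=> a0 b0 fm; rewrite /rescale.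
set g := mero_fun _.
have gm : meromorphic_germ g by apply/asboolP; rewrite /g; case: (repr _).
have gf : mero_of g = mero_of f.
  rewrite -[RHS]reprK /mero_of; congr (\pi _); apply: val_inj => /=.
  by rewrite insubdK //; apply/asboolP.
apply/(mero_of_eqP (meromorphic_germ_sc a0 b0 gm) (meromorphic_germ_sc a0 b0 fm)).
by apply: (negligible_germ_sc a0 b0 (f := g - f)); apply/(mero_of_eqP gm fm).
Qed.

Lemma rescale1 F : rescale 1 1 F = F.
Proof.
have [f fm ->] := mero_ofP F; rewrite rescale_mero_of ?oner_neq0 //.
by congr mero_of; apply/funext => -[z p]; rewrite /= !mul1r.
Qed.

Lemma rescaleM a b a' b' F : a != 0 -> b != 0 -> a' != 0 -> b' != 0 ->
  rescale a b (rescale a' b' F) = rescale (a * a') (b * b') F.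
Proof.
move=> a0 b0 a'0 b'0; have [f fm ->] := mero_ofP F.
rewrite !rescale_mero_of ?mulf_neq0 //; last exact: (meromorphic_germ_sc a'0 b'0).
by congr mero_of; apply/funext => -[z p]; rewrite /= !mulrA ![_ * a]mulrC ![_ * b]mulrC.
Qed.

Definition mero_cst (c : K) : mero := mero_of (cst c).
Definition mero_z : mero := mero_of fst.
Definition mero_p : mero := mero_of snd.

End Germs.

Section Partitions.

Record intpart := IntPart {
  parts : seq nat;
  _ : sorted geq parts && (0%N \notin parts) }.

HB.instance Definition _ := [isSub for parts].
HB.instance Definition _ := [Countable of intpart by <:].

Definition psize (la : intpart) : nat := sumn (parts la).

End Partitions.

Section Data.
Variable R : realType.
Local Notation C := (R[i] : numFieldType).

(* (z; t1, t2)_oo *)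
Definition qpoch2 (z t1 t2 : C) : C :=
  lim ((fun n : nat =>
    \prod_(m1 < n) \prod_(m2 < n) (1 - z * t1 ^+ m1 * t2 ^+ m2) : C) @ \oo).

(* The nome p is not a parameter here: it is the second variable of the
   functions in [mero C], because ps = p gamma^-2 (p-star) is not a scalar in U
   and the twisted tensor product identifies ps of a factor with p of the next
   one. *)
Record parameters := MkParameters {
  t1 : C;
  t2 : C;
  sqrth : C;
  t1_bound : 0 < `|t1| < 1;
  t2_bound : 0 < `|t2| < 1;
  t_generic : forall a b : int, t1 ^ a * t2 ^ b = 1 -> a = 0 /\ b = 0;
  sqrthE : sqrth ^+ 2 = t1 * t2 }.

Definition hbar (q : parameters) : C := t1 q * t2 q.

(* The poles in u, v of the R-matrix and of products of vertex operators depend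
   on u / v only, hence the shape of the exceptional set. *)
Definition for_generic (P : C -> C -> Prop) :=
  exists2 B : set C, countable B &
    forall u v : C, u != 0 -> v != 0 -> ~ B (u / v) -> P u v.

(* [Rent mu nu mu' nu' u v z p] is the entry with lower indices mu, nu and
   upper indices mu', nu'; its values at poles are irrelevant.  [Rent_slice]
   says that (u, v) generically is off the components of the polar divisor on
   which u / v is constant. *)
Record rmatrix := RMatrix {
  Rent : intpart -> intpart -> intpart -> intpart -> C -> C -> C -> C -> C;
  Rent_weight : forall mu nu mu' nu' u v z p,
    psize mu + psize nu <> psize mu' + psize nu' ->
    Rent mu nu mu' nu' u v z p = 0;
  Rent_mero : forall mu nu mu' nu', exists2 e : C, 0 < e &
    meromorphic_on
      [set x : C * C * C * C |
        [/\ x.1.1.1 != 0, x.1.1.2 != 0, x.1.2 != 0 & 0 < `|x.2| < e]]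
      (fun x => Rent mu nu mu' nu' x.1.1.1 x.1.1.2 x.1.2 x.2 : C);
  Rent_slice : for_generic (fun u v => forall mu nu mu' nu',
    meromorphic_germ (fun x : C * C => Rent mu nu mu' nu' u v x.1 x.2)) }.

(* As operators, the entries of R^+(u, v; z) are the images of these under [fz],
   and those of R^+(u, v; zs) with nome ps, i.e. of the starred R-matrix, are
   their images under [fzs]. *)
Definition Rmat (A : rmatrix) mu nu mu' nu' (u v : C) : mero C :=
  mero_of (fun x => Rent A mu nu mu' nu' u v x.1 x.2).

Definition R_shift_invariant (q : parameters) (A : rmatrix) :=
  for_generic (fun u v => forall mu nu mu' nu',
    rescale (hbar q ^- 2) 1 (Rmat A mu nu mu' nu' u v)
      = Rmat A mu nu mu' nu' u v).

Definition R_ratio_dependent (A : rmatrix) :=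
  for_generic (fun u v => forall a : C, a != 0 -> forall mu nu mu' nu',
    Rmat A mu nu mu' nu' (a * u) (a * v) = Rmat A mu nu mu' nu' u v).

End Data.

Section Algebra.
Variables (R : realType) (q : parameters R).
Local Notation C := (R[i] : numFieldType).
Local Notation M := (mero C).
Local Notation h := (hbar q).

(* [fz F] is F(z, p) and [fzs F] is F(zs, ps), where z = h^(P-c), and zs = h^P,
   ps = p gamma^-2 are the starred parameters; [gam], [hc], [expQ], [expNQ] are
   gamma, h^c, e^Q, e^-Q.  [expQ_fz] and [expQ_fzs] express [P, Q] = 1. *)
Record toroidal := Toroidal {
  tor_alg :> algType R[i];
  fz : {rmorphism M -> tor_alg};
  fzs : {rmorphism M -> tor_alg};
  fz_cst : forall c : C, fz (mero_cst c) = c%:A;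
  fzs_cst : forall c : C, fzs (mero_cst c) = c%:A;
  fz_fzsC : forall F G, fz F * fzs G = fzs G * fz F;
  gam : tor_alg;
  gamV : tor_alg;
  gam_central : forall x, gam * x = x * gam;
  gam_gamV : gam * gamV = 1;
  hc : tor_alg;
  hcV : tor_alg;
  hc_central : forall x, hc * x = x * hc;
  hc_hcV : hc * hcV = 1;
  fzs_z : fzs (mero_z C) = fz (mero_z C) * hc;
  fzs_p : fzs (mero_p C) = fz (mero_p C) * gamV ^+ 2;
  expQ : tor_alg;
  expNQ : tor_alg;
  expQ_NQ : expQ * expNQ = 1;
  expNQ_Q : expNQ * expQ = 1;
  expQ_fz : forall F, expQ * fz F = fz (rescale h^-1 1 F) * expQ;
  expQ_fzs : forall F, expQ * fzs F = fzs (rescale h^-1 1 F) * expQ }.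

Variable E : toroidal.

(* A module on which gamma acts by [lev_g] and c by [lev_c]. *)
Record level_module := LevelModule {
  lev_mod :> lmodType E;
  lev_g : C;
  lev_c : int;
  lev_g_neq0 : lev_g != 0;
  lev_gam : forall x : lev_mod, gam E *: x = lev_g%:A *: x;
  lev_hc : forall x : lev_mod, hc E *: x = (h ^ lev_c)%:A *: x;
  lev_fzs : forall F (x : lev_mod),
    fzs E F *: x = fz E (rescale (h ^ lev_c) (lev_g ^- 2) F) *: x }.

Section Tensor.
Variables V W : lmodType E.

Definition balanced (X : zmodType) (b : V -> W -> X) :=
  [/\ forall v v' w, b (v + v') w = b v w + b v' w,
      forall v w w', b v (w + w') = b v w + b v w'
    & forall F v w, b (fzs E F *: v) w = b v (fz E F *: w)].

Definition formal_eval (X : zmodType) (b : V -> W -> X) (s : seq (V * W)) : X :=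
  \sum_(x <- s) b x.1 x.2.

(* Formal sums of pure tensors are equal when no balanced map separates them. *)
Definition formal_equiv (s t : seq (V * W)) : bool :=
  `[< forall (X : zmodType) (b : V -> W -> X),
        balanced b -> formal_eval b s = formal_eval b t >].

Lemma formal_equiv_class : equiv_class_of formal_equiv.
Proof.
split=> [s|s t|t s u].
- by apply/asboolP.
- by apply/asboolP/asboolP => st X b bb; rewrite st.
- by move=> /asboolP st /asboolP tu; apply/asboolP => X b bb; rewrite st // tu.
Qed.

Canonical formal_equiv_rel := EquivRelPack formal_equiv_class.
Canonical formal_equiv_enc := defaultEncModRel formal_equiv.

Definition tens := {eq_quot formal_equiv}.
HB.instance Definition _ : EqQuotient _ formal_equiv tens := EqQuotient.on tens.
HB.instance Definition _ := Choice.on tens.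

Lemma tens_eqP s t : \pi_tens s = \pi_tens t <->
  forall (X : zmodType) (b : V -> W -> X),
    balanced b -> formal_eval b s = formal_eval b t.
Proof.
split=> [/eqP|st]; first by rewrite piE => /asboolP.
by apply/eqP; rewrite piE; apply/asboolP.
Qed.

Lemma formal_eval_repr (X : zmodType) (b : V -> W -> X) s : balanced b ->
  formal_eval b (repr (\pi_tens s)) = formal_eval b s.
Proof. by move=> bb; apply: (iffLR (tens_eqP _ _)) => //; rewrite reprK. Qed.

Definition formal_opp (s : seq (V * W)) := [seq (- x.1, x.2) | x <- s].

Definition tens0 : tens := \pi_tens [::].
Definition tens_opp (x : tens) : tens := \pi_tens (formal_opp (repr x)).
Definition tens_add (x y : tens) : tens := \pi_tens (repr x ++ repr y).

Lemma formal_eval_cat (X : zmodType) (b : V -> W -> X) s t :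
  formal_eval b (s ++ t) = formal_eval b s + formal_eval b t.
Proof. exact: big_cat. Qed.

Lemma formal_eval_opp (X : zmodType) (b : V -> W -> X) s : balanced b ->
  formal_eval b (formal_opp s) = - formal_eval b s.
Proof.
move=> [bD _ _]; rewrite /formal_eval big_map -sumrN; apply: eq_bigr => x _ /=.
have b0 w : b 0 w = 0 by apply: (addrI (b 0 w)); rewrite -bD !addr0.
by apply/eqP; rewrite -addr_eq0 -bD addNr b0.
Qed.

Lemma tens_ext (x y : tens) :
  (forall (X : zmodType) (b : V -> W -> X), balanced b ->
    formal_eval b (repr x) = formal_eval b (repr y)) -> x = y.
Proof. by move=> xy; rewrite -[x]reprK -[y]reprK; apply/tens_eqP. Qed.

Lemma tens_addA : associative tens_add.
Proof.
move=> x y z; apply/tens_eqP => X b bb.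
by rewrite !formal_eval_cat !formal_eval_repr // !formal_eval_cat addrA.
Qed.

Lemma tens_addC : commutative tens_add.
Proof.
by move=> x y; apply/tens_eqP => X b bb; rewrite !formal_eval_cat addrC.
Qed.

Lemma tens_add0 : left_id tens0 tens_add.
Proof.
move=> x; apply/tens_ext => X b bb.
by rewrite formal_eval_repr // formal_eval_cat formal_eval_repr // [formal_eval b [::]]big_nil add0r.
Qed.

Lemma tens_addN : left_inverse tens0 tens_opp tens_add.
Proof.
move=> x; apply/tens_eqP => X b bb.
rewrite formal_eval_cat formal_eval_repr // formal_eval_opp // addNr.
by rewrite [formal_eval b [::]]big_nil.
Qed.

HB.instance Definition _ :=
  GRing.isZmodule.Build tens tens_addA tens_addC tens_add0 tens_addN.

Definition pure (v : V) (w : W) : tens := \pi_tens [:: (v, w)].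

Definition tens_lift (X : zmodType) (b : V -> W -> X) (x : tens) : X :=
  formal_eval b (repr x).

Lemma pure_balanced : balanced pure.
Proof.
split.
- move=> v v' w; apply/tens_eqP => X b bb; rewrite formal_eval_cat !formal_eval_repr //.
  by case: (bb) => bD _ _; rewrite /formal_eval !big_seq1 bD.
- move=> v w w'; apply/tens_eqP => X b bb; rewrite formal_eval_cat !formal_eval_repr //.
  by case: (bb) => _ bD _; rewrite /formal_eval !big_seq1 bD.
- move=> F v w; apply/tens_eqP => X b bb.
  by case: (bb) => _ _ bF; rewrite /formal_eval !big_seq1 bF.
Qed.

Lemma tens_lift_pure (X : zmodType) (b : V -> W -> X) v w : balanced b ->
  tens_lift b (pure v w) = b v w.
Proof.
by move=> bb; rewrite /tens_lift formal_eval_repr // /formal_eval big_seq1.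
Qed.

Lemma tens_liftD (X : zmodType) (b : V -> W -> X) : balanced b ->
  {morph tens_lift b : x y / x + y}.
Proof.
by move=> bb x y; rewrite /tens_lift formal_eval_repr // formal_eval_cat.
Qed.

End Tensor.

(* The level-(0,-1) module: |la> is a basis over the functions of (zs, ps). *)
Record fock0 := Fock0 {
  f0_mod :> level_module;
  f0_g : lev_g f0_mod = 1;
  f0_c : lev_c f0_mod = -1;
  ket : intpart -> f0_mod;
  coord : f0_mod -> intpart -> M;
  coord_finite : forall x, finite_set [set la | coord x la != 0];
  coordK : forall x,
    x = \sum_(la \in [set: intpart]) fzs E (coord x la) *: ket la;
  coord_unique : forall f : intpart -> M, finite_set [set la | f la != 0] ->
    coord (\sum_(la \in [set: intpart]) fzs E (f la) *: ket la) = f;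
  expQ_ket : forall la, expQ E *: ket la = ket la;
  expNQ_ket : forall la, expNQ E *: ket la = ket la }.

(* The completion of [tens F W] in which formal infinite sums
   sum_la |la> (x) w_la make sense, such a sum being the family (w_la). *)
Definition ctens (W : lmodType E) : zmodType := intpart -> W.

Definition completion (F : fock0) (W : lmodType E) : tens F W -> ctens W :=
  tens_lift (fun (a : F) (w : W) la => fz E (coord a la) *: w).

Lemma fock0_sum_widen (F : fock0) (f : intpart -> M) (D : set intpart) :
  [set la | f la != 0] `<=` D ->
  \sum_(la \in [set: intpart]) fzs E (f la) *: ket F la =
  \sum_(la \in D) fzs E (f la) *: ket F la.
Proof.
move=> fD; apply/esym/fsbig_widen => // la [_ nD] /=.
have [->|/fD//] := eqVneq (f la) 0; by rewrite rmorph0 scale0r.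
Qed.

Lemma coordD (F : fock0) (x y : F) la :
  coord (x + y) la = coord x la + coord y la.
Proof.
pose D := [set la | coord x la != 0] `|` [set la | coord y la != 0].
pose f la := coord x la + coord y la.
have finD : finite_set D by rewrite finite_setU; split; exact: coord_finite.
have fD : [set la | f la != 0] `<=` D.
  move=> ka; rewrite /f /=; case: (eqVneq (coord x ka) 0) => [-> |]; last by left.
  by rewrite add0r; right.
rewrite -[RHS]/(f la) -(coord_unique F (sub_finite_set fD finD)).
congr (coord _ _); rewrite (fock0_sum_widen F fD) {1}(coordK x) {1}(coordK y).
rewrite (fock0_sum_widen F (@subsetUl _ _ [set la | coord y la != 0])).
rewrite (fock0_sum_widen F (@subsetUr _ [set la | coord x la != 0] _)).
rewrite -fsbig_split //; apply: eq_fsbigr => ka _.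
by rewrite /= -scalerDl -rmorphD.
Qed.

Lemma coordZ (F : fock0) (G : M) (x : F) la :
  coord (fzs E G *: x) la = G * coord x la.
Proof.
pose f la := G * coord x la.
have fD : [set la | f la != 0] `<=` [set la | coord x la != 0].
  by move=> ka /=; apply: contra_neq => x0; rewrite /f x0 mulr0.
rewrite -[RHS]/(f la) -(coord_unique F (sub_finite_set fD (coord_finite x))).
congr (coord _ _); rewrite (fock0_sum_widen F fD) {1}(coordK x).
rewrite (fock0_sum_widen F (@subset_refl _ _)).
rewrite !(fsbig_finite _ _ (coord_finite x)) scaler_sumr.
by apply: eq_bigr => ka _; rewrite scalerA -rmorphM.
Qed.

Lemma completion_balanced (F : fock0) (W : lmodType E) :
  @balanced F W (ctens W) (fun a w la => fz E (coord a la) *: w).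
Proof.
split=> [x y w|x w w'|G x w]; apply/funext => la.
- by rewrite coordD rmorphD scalerDl.
- by rewrite scalerDr.
- by rewrite coordZ [G * _]mulrC rmorphM scalerA.
Qed.

Lemma completion_pure (F : fock0) (W : lmodType E) (a : F) (w : W) la :
  completion (pure a w) la = fz E (coord a la) *: w.
Proof. by rewrite /completion tens_lift_pure //; exact: completion_balanced. Qed.

(* An element sum_la a_la (x) b_la of the completed tensor square of U is
   represented by the family (a_la, b_la). *)
Definition act_tens (V W : lmodType E) (X : intpart -> E * E) (v : V) (w : W)
    : tens V W :=
  \sum_(la \in [set: intpart]) pure ((X la).1 *: v) ((X la).2 *: w).

Definition act_ctens (F : fock0) (W : lmodType E) (X : intpart -> E * E)
    (xi : ctens W) : ctens W := fun ka =>
  \sum_(x \in [set: intpart * intpart])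
    completion (pure ((X x.1).1 *: ket F x.2) ((X x.1).2 *: xi x.2)) ka.

(* The universal L-operator; [LU] is L^+(u) = L^+(u; zs) e^-Q and
   [Lop_hat] is L^+(u; zs), in which Q does not occur. *)
Record universal_L (A : rmatrix R) := UniversalL {
  LU : intpart -> intpart -> C -> E;
  Lop_hat : intpart -> intpart -> C -> E;
  LU_expNQ : forall mu nu u, LU mu nu u = Lop_hat mu nu u * expNQ E;
  Lop_hat_fz : forall mu nu u F,
    Lop_hat mu nu u * fz E F = fz E F * Lop_hat mu nu u;
  Lop_hat_fzs : forall mu nu u F,
    Lop_hat mu nu u * fzs E F = fzs E F * Lop_hat mu nu u;
  LU_RLL : for_generic (fun u v => forall mu nu mu'' nu'',
    \sum_(x \in [set: intpart * intpart])
      fz E (Rmat A mu nu x.1 x.2 u v) * LU x.1 mu'' u * LU x.2 nu'' v =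
    \sum_(x \in [set: intpart * intpart])
      LU nu x.2 v * LU mu x.1 u * fzs E (Rmat A x.1 x.2 mu'' nu'' u v)) }.

(* Delta (L^+_{mu nu}(u)) on a tensor product with second factor W, where the
   gamma of the second factor is the scalar [lev_g W] *)
Definition Delta_L (A : rmatrix R) (L : universal_L A) (W : level_module)
    (mu nu : intpart) (u : C) : intpart -> E * E :=
  fun la => (LU L mu la (u * lev_g W), LU L la nu u).

(* [f1 N] is the direct sum over w of the Fock modules [f1w N w] of level
   (1,N); it is on this sum that U acts, since L^+(u) changes w.  [Psi N v] has
   target of level (1,N), which avoids casts along N - 1 + 1 = N. *)
Record vertex_system := VertexSystem {
  f1 : int -> level_module;
  f1_g : forall N, lev_g (f1 N) = sqrth q;
  f1_c : forall N, lev_c (f1 N) = N;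
  f1w : forall N, C -> set (f1 N);
  f1w_0 : forall N w, f1w w (0 : f1 N);
  f1w_D : forall N w (x y : f1 N), f1w w x -> f1w w y -> f1w w (x + y);
  f1w_fz : forall N w F (x : f1 N), f1w w x -> f1w w (fz E F *: x);
  f1w_span : forall N (x : f1 N), exists s : seq C, exists y : C -> f1 N,
    [/\ 0 \notin s, forall w, f1w w (y w) & x = \sum_(w <- s) y w];
  f1w_direct : forall N (s : seq C) (y : C -> f1 N), uniq s -> 0 \notin s ->
    (forall w, f1w w (y w)) -> \sum_(w <- s) y w = 0 ->
    forall w, w \in s -> y w = 0;
  f0 : C -> fock0;
  Phi : forall N (v : C), {additive f1 N -> ctens (f1 (N + 1))};
  Psi : forall N (v : C), {additive tens (f1 (N + 1)) (f0 v) -> f1 N};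
  Phi_w : forall N v w (xi : f1 N) la, v != 0 -> f1w w xi ->
    f1w (- (w / v)) (Phi N v xi la);
  Psi_w : forall N v w (xi : f1 (N + 1)) la, v != 0 -> f1w w xi ->
    f1w (- (w * v)) (Psi N v (pure xi (ket (f0 v) la)));
  Phi_fz : forall N v F (xi : f1 N) la, v != 0 ->
    fz E F *: Phi N v xi la = Phi N v (fz E (rescale h^-1 1 F) *: xi) la;
  Phi_fzs : forall N v F (xi : f1 N) la, v != 0 ->
    fzs E F *: Phi N v xi la = Phi N v (fzs E F *: xi) la;
  Psi_fzs : forall N v F (xi : f1 (N + 1)) la, v != 0 ->
    Psi N v (pure (fzs E F *: xi) (ket (f0 v) la)) =
    fzs E (rescale h 1 F) *: Psi N v (pure xi (ket (f0 v) la));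
  Psi_fz : forall N v F (xi : f1 (N + 1)) la, v != 0 ->
    Psi N v (pure (fz E F *: xi) (ket (f0 v) la)) =
    fz E F *: Psi N v (pure xi (ket (f0 v) la)) }.

Variable S : vertex_system.

Definition Phi_comp N (v : C) la (xi : f1 S N) : f1 S (N + 1) :=
  Phi S N v xi la.

Definition Psi_comp N (v : C) la (xi : f1 S (N + 1)) : f1 S N :=
  Psi S N v (pure xi (ket (f0 S v) la)).

Definition Lop N mu nu (u : C) (xi : f1 S N) : f1 S N :=
  (qpoch2 h (t1 q) (t2 q))%:A *:
    Psi_comp u nu (Phi_comp (sqrth q * u) mu xi).

(* gamma = 1 on [f0], so the nomes p and ps agree there. *)
Definition acts_on_fock0 (A : rmatrix R) (L : universal_L A) :=
  for_generic (fun u v => forall mu nu la,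
    LU L mu nu u *: ket (f0 S v) la =
    \sum_(la' \in [set: intpart])
      fzs E (Rmat A mu la' nu la u v) *: ket (f0 S v) la').

Definition acts_on_fock1 (A : rmatrix R) (L : universal_L A) :=
  forall N mu nu (u : C) (xi : f1 S N), u != 0 ->
    LU L mu nu u *: xi = Lop mu nu u xi.

End Algebra.

(* Main.v *)
(* Evaluated on basis vectors, both comultiplication formulas become the
   exchange relations once the R-matrix entries have been moved to the right
   place.  For type I, the argument [u * sqrth] of the R-matrix is absorbed in
   [v] by the dependence on [u / v].  For type II, an entry F(zs) acting on the
   level-(0,-1) factor is F(h^-1 z) there, hence F(h^-1 zs) on the first factor;
   moving it through L^+, which contains e^-Q, gives F(h^-2 zs), and this is F(zs)
   by the shift invariance.  All sums are finite since the R-matrix preserves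
   the total weight. *)
Require Import Defs.
From mathcomp Require Import all_boot all_order all_algebra.
From mathcomp Require Import all_classical all_reals all_analysis.
From mathcomp Require Import complex.
Set Implicit Arguments.
Unset Strict Implicit.
Unset Printing Implicit Defensive.
Import Order.TTheory GRing.Theory Num.Theory numFieldNormedType.Exports.
Local Open Scope classical_set_scope.
Local Open Scope ring_scope.

Lemma leq_sumn (s : seq nat) k : (k \in s -> k <= sumn s)%N.
Proof.
elim: s => //= a s IH; rewrite inE => /orP[/eqP->|/IH ks]; first exact: leq_addr.
exact: leq_trans ks (leq_addl _ _).
Qed.

Lemma size_leq_sumn (s : seq nat) : (0 \notin s -> size s <= sumn s)%N.
Proof.
elim: s => //= a s IH; rewrite inE negb_or eq_sym -lt0n => /andP[a0 /IH ss].
by rewrite -add1n leq_add.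
Qed.

(** A partition of size at most [n] has at most [n] parts, each at most [n], so it comes from a
    bounded sequence over ['I_n.+1]. *)
Lemma finite_psize_le n : finite_set [set la | (psize la <= n)%N].
Proof.
(* The empty partition is the default value on sequences that are not the parts of a partition. *)
pose g (b : n.-bseq 'I_n.+1) : intpart :=
  insubd (IntPart (isT : sorted geq [::] && (0 \notin [::])))%N (map val b).
apply: (@sub_finite_set _ _ (g @` [set: n.-bseq 'I_n.+1])); last first.
  exact/finite_image/finite_finset.
move=> la /= lan; case: (elimT andP (valP la)) => /= _ la0.
have sn : (size (map (@inord n) (parts la)) <= n)%N.
  by rewrite size_map (leq_trans (size_leq_sumn la0)).
exists (Bseq sn) => //; apply: val_inj; rewrite /g /=.
have -> : map val (map (@inord n) (parts la)) = parts la.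
  rewrite -map_comp map_id_in // => k kla /=.
  by rewrite inordK // ltnS (leq_trans (leq_sumn kla)).
by rewrite val_insubd (valP la).
Qed.

(** Serves to pass from the commutation relation of e^Q to that of e^-Q. *)
Lemma inv_twist (T : pzRingType) (a b x y : T) :
  a * b = 1 -> b * a = 1 -> a * x = y * a -> b * y = x * b.
Proof.
move=> ab ba ax; rewrite -[LHS]mulr1 -ab mulrA -(mulrA b) -ax.
by rewrite !mulrA ba mul1r.
Qed.

Lemma mul_twist (T : pzRingType) (a b x y : T) :
  b * x = y * b -> a * y = y * a -> a * b * x = y * (a * b).
Proof. by move=> bx ay; rewrite -mulrA bx !mulrA ay. Qed.

(** Shift both sides of the invariance by [a]. With [a] = h this trades the h produced by e^-Q for
    the h^-1 relating zs to z at level (0,-1). *)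
Lemma rescaleV_shift (K : numFieldType) (a : K) (F : mero K) : a != 0 ->
  rescale (a ^- 2) 1 F = F -> rescale a^-1 1 F = rescale a 1 F.
Proof.
move=> a0 Fa; have a2 : a ^- 2 != 0 by rewrite invr_eq0 expf_neq0.
have := rescaleM F a0 (oner_neq0 K) a2 (oner_neq0 K).
by rewrite Fa expr2 invfM mulVKf // mulr1 => ->.
Qed.

Section ForGeneric.
Variable R : realType.
Local Notation C := (R[i] : numFieldType).
Implicit Types P Q : C -> C -> Prop.

Lemma for_generic_and P Q : for_generic P -> for_generic Q ->
  for_generic (fun u v => P u v /\ Q u v).
Proof.
move=> [B1 c1 P1] [B2 c2 Q2]; exists (B1 `|` B2).
  by rewrite -bigcup2E; apply: bigcup_countable => // -[|[|i]] _.
by move=> u v u0 v0 /not_orP[? ?]; split; auto.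
Qed.

Lemma for_generic_sub P Q :
  (forall u v, u != 0 -> v != 0 -> P u v -> Q u v) ->
  for_generic P -> for_generic Q.
Proof. by move=> PQ [B cB PB]; exists B => // u v u0 v0 uv; apply: PQ; auto. Qed.

(** The exceptional set restricts only [u / v], so rescaling one argument multiplies that set by a
    constant and keeps it countable. *)
Lemma for_generic_scaler P (a : C) : a != 0 -> for_generic P ->
  for_generic (fun u v => P u (a * v)).
Proof.
move=> a0 [B cB PB]; exists ((fun r => a * r) @` B).
  exact: card_le_trans (card_image_le _ _) cB.
move=> u v u0 v0 nB; apply: PB => //; first exact: mulf_neq0.
move=> Buv; apply: nB; exists (u / (a * v)) => //.
by rewrite invfM mulrCA mulVKf.
Qed.

Lemma for_generic_scalel P (a : C) : a != 0 -> for_generic P ->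
  for_generic (fun u v => P (a * u) v).
Proof.
move=> a0 [B cB PB]; exists ((fun r => a^-1 * r) @` B).
  exact: card_le_trans (card_image_le _ _) cB.
move=> u v u0 v0 nB; apply: PB => //; first exact: mulf_neq0.
by move=> Buv; apply: nB; exists (a * u / v); rewrite // -mulrA mulKf.
Qed.

End ForGeneric.

Section Intertwining.
Variables (R : realType) (q : parameters R) (A : rmatrix R).
Local Notation C := (R[i] : numFieldType).
Local Notation h := (hbar q).

Lemma hbar_neq0 : h != 0.
Proof.
rewrite mulf_neq0 // -normr_gt0; first by case/andP: (t1_bound q).
by case/andP: (t2_bound q).
Qed.

Lemma sqrth_neq0 : sqrth q != 0.
Proof. by rewrite -sqrf_eq0 sqrthE hbar_neq0. Qed.

Lemma Rmat_weight mu nu mu' nu' (u v : C) :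
  (psize mu + psize nu)%N <> (psize mu' + psize nu')%N ->
  Rmat A mu nu mu' nu' u v = 0.
Proof.
move=> w; rewrite /Rmat /mero_of.
have -> : (fun x : C * C => Rent A mu nu mu' nu' u v x.1 x.2) = 0.
  by apply/funext => x; rewrite Rent_weight.
rewrite (_ : insubd _ _ = 0) ?raddf0 //.
(* Both branches give 0: the function is 0 and so is the default value. *)
by apply: val_inj; rewrite /= val_insubd; case: ifP.
Qed.

(** Conservation of weight bounds the size of [la'] by that of [nu] and [la] together. This
    finiteness is what [coord_unique] asks for. *)
Lemma Rmat_finite mu nu la (u v : C) :
  finite_set [set la' | Rmat A mu la' nu la u v != 0].
Proof.
apply: sub_finite_set (finite_psize_le (psize nu + psize la)) => la' /=.
apply: contra_neqP => lt; apply: Rmat_weight => w; apply: lt.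
by rewrite -w leq_addl.
Qed.

Variable E : toroidal q.

Lemma expNQ_fzs F : expNQ E * fzs E F = fzs E (rescale h 1 F) * expNQ E.
Proof.
apply: (inv_twist (expQ_NQ E) (expNQ_Q E)); rewrite expQ_fzs rescaleM //.
- by rewrite mulVf ?hbar_neq0 // mulr1 rescale1.
- by rewrite invr_eq0 hbar_neq0.
- exact: hbar_neq0.
Qed.

(** [Lop_hat] commutes with functions of zs and ps, so the whole shift comes from e^-Q. *)
Lemma LU_fzs (L : universal_L E A) mu nu u F :
  LU L mu nu u * fzs E F = fzs E (rescale h 1 F) * LU L mu nu u.
Proof.
rewrite LU_expNQ.
exact: mul_twist (expNQ_fzs F) (Lop_hat_fzs L mu nu u (rescale h 1 F)).
Qed.

Lemma LU_fzs_shift (L : universal_L E A) mu nu u (F : mero C) :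
    rescale (h ^- 2) 1 F = F ->
  LU L mu nu u * fzs E F = fzs E (rescale h^-1 1 F) * LU L mu nu u.
Proof. by move=> /(rescaleV_shift hbar_neq0) ->; exact: LU_fzs. Qed.

(** Here gamma = 1 and c = -1, so zs = h^-1 z and the nome does not change. *)
Lemma fock0_fzs (F0 : fock0 E) F (x : F0) :
  fzs E F *: x = fz E (rescale h^-1 1 F) *: x.
Proof. by rewrite lev_fzs f0_g f0_c exprN1 expr1n invr1. Qed.

Variables (S : vertex_system E) (L : universal_L E A).
Hypothesis hL1 : acts_on_fock1 S L.

(** Acting on a basis vector yields R-matrix entries in (zs, ps) of the first factor; taking the
    coordinate at [ka] carries the entry to the second factor as a function of (z, p). The factor
    [sqrth q] is the gamma of the second factor. *)
Lemma type_I_term mu nu u v N (xi : f1 S N) ka (x : intpart * intpart) :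
    u != 0 ->
    (forall nu' la, LU L mu nu' (u * sqrth q) *: ket (f0 S v) la =
      \sum_(la' \in [set: intpart])
        fzs E (Rmat A mu la' nu' la (u * sqrth q) v) *: ket (f0 S v) la') ->
  completion (pure ((Delta_L L (f1 S (N + 1)) mu nu u x.1).1 *: ket (f0 S v) x.2)
    ((Delta_L L (f1 S (N + 1)) mu nu u x.1).2 *: Phi S N v xi x.2)) ka =
  fz E (Rmat A mu ka x.1 x.2 (u * sqrth q) v) *:
    Lop x.1 nu u (Phi_comp v x.2 xi).
Proof.
move=> u0 act0; rewrite completion_pure /Delta_L /= f1_g act0.
by rewrite coord_unique ?hL1 //; exact: Rmat_finite.
Qed.

Lemma type_II_sum mu nu la u v N (xi : f1 S (N + 1)) :
    u != 0 ->
    (forall mu' nu', LU L mu' nu u *: ket (f0 S v) nu' =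
      \sum_(la' \in [set: intpart])
        fzs E (Rmat A mu' la' nu nu' u v) *: ket (f0 S v) la') ->
    (forall mu nu mu' nu',
      rescale (h ^- 2) 1 (Rmat A mu nu mu' nu' u v) = Rmat A mu nu mu' nu' u v) ->
  Psi S N v (act_tens (Delta_L L (f0 S v) mu nu u) xi (ket (f0 S v) la)) =
  \sum_(x \in [set: intpart * intpart])
    Psi_comp v x.2 (Lop mu x.1 u (fzs E (Rmat A x.1 x.2 nu la u v) *: xi)).
Proof.
move=> u0 act0 shift.
(* A nonzero entry has |k| + |l| = |nu| + |la|, so [D] contains both the intermediate partition [k]
   of the comultiplication and the resulting basis index [l]. *)
pose D := [set la' | (psize la' <= psize nu + psize la)%N].
have finD : finite_set D by exact: finite_psize_le.
have R0 k l : ~ (D k /\ D l) -> Rmat A k l nu la u v = 0.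
  move=> nD; apply: Rmat_weight => w; apply: nD.
  by rewrite /D /= -w leq_addr leq_addl.
have bal := pure_balanced (f1 S (N + 1)) (f0 S v).
have pure0 x : pure x (0 : f0 S v) = 0 :> tens (f1 S (N + 1)) (f0 S v).
  by case: bal => _ bD _; apply: (addrI (pure x 0)); rewrite -bD !addr0.
have pure_sum x (s : seq intpart) (F : intpart -> f0 S v) :
    pure x (\sum_(k <- s) F k) = \sum_(k <- s) pure x (F k)
    :> tens (f1 S (N + 1)) (f0 S v).
  by case: bal => _ bD _; exact: (big_morph (pure x) (bD x) (pure0 x)).
have term k l : Psi S N v (pure (LU L mu k u *: xi)
      (fzs E (Rmat A k l nu la u v) *: ket (f0 S v) l)) =
    Psi_comp v l (Lop mu k u (fzs E (Rmat A k l nu la u v) *: xi)).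
  (* The entry, shifted by h^-1, crosses to the first factor and lands to the left of L^+; passing
     it to the right of L^+ removes the shift. *)
  rewrite fock0_fzs; case: bal => _ _ <-.
  rewrite -hL1 // /Psi_comp; congr (Psi S N v (pure _ _)).
  apply: etrans (scalerA _ _ _) _; rewrite -(LU_fzs_shift L _ _ _ (shift k l nu la)).
  exact: esym (scalerA _ _ _).
rewrite /act_tens -(@fsbig_widen _ _ _ _ D) //; last first.
  move=> k [_ nD] /=; rewrite act0 fsbig1 ?pure0 // => l _.
  by rewrite R0 ?rmorph0 ?scale0r // => -[].
rewrite -(@fsbig_widen _ _ _ _ (D `*` D)) //; last first.
  by move=> [k l] [_ nD] /=; rewrite -term R0 // rmorph0 scale0r pure0 raddf0.
(* The outer index [k] is summed by the comultiplication, the inner index [l] by the action on the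
   basis vector. *)
rewrite -(pair_fsbig _ (fun k l =>
  Psi_comp v l (Lop mu k u (fzs E (Rmat A k l nu la u v) *: xi)))) //=.
rewrite fsbig_finite //= raddf_sum fsbig_finite //=.
apply: eq_bigr => k _; rewrite f0_g mulr1 act0.
rewrite (@fock0_sum_widen _ _ _ _ _ D); last first.
  by move=> l /=; apply: contra_neqP => nD; apply: R0 => -[].
rewrite fsbig_finite //= pure_sum raddf_sum fsbig_finite //=.
by apply: eq_bigr => l _; exact: term.
Qed.

End Intertwining.

Theorem proposition7p4 (R : realType) (q : parameters R) (A : rmatrix R)
  (hshift : R_shift_invariant q A)
  (hratio : R_ratio_dependent A)
  (E : toroidal q) (S : vertex_system E) (L : universal_L E A)
  (hL0 : acts_on_fock0 S L)
  (hL1 : acts_on_fock1 S L) :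
  (* type I *)
  (for_generic (fun u v => forall (N : int) (mu nu mu'' : intpart) (xi : f1 S N),
      Phi_comp (sqrth q * v) nu (Lop mu mu'' u xi) =
      \sum_(x \in [set: intpart * intpart])
        fz E (Rmat A mu nu x.1 x.2 u v) *:
          Lop x.1 mu'' u (Phi_comp (sqrth q * v) x.2 xi))
   <->
   for_generic (fun u v => forall (N : int) (mu nu : intpart) (xi : f1 S N),
      Phi S N v (LU L mu nu u *: xi) =
      act_ctens (f0 S v) (Delta_L L (f1 S (N + 1)) mu nu u) (Phi S N v xi)))
  /\
  (* type II *)
  (for_generic (fun u v => forall (N : int) (mu mu'' nu'' : intpart)
        (xi : f1 S (N + 1)),
      Lop mu mu'' u (Psi_comp v nu'' xi) =
      \sum_(x \in [set: intpart * intpart])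
        Psi_comp v x.2
          (Lop mu x.1 u (fzs E (Rmat A x.1 x.2 mu'' nu'' u v) *: xi)))
   <->
   for_generic (fun u v => forall (N : int) (mu nu la : intpart)
        (xi : f1 S (N + 1)),
      LU L mu nu u *: Psi S N v (pure xi (ket (f0 S v) la)) =
      Psi S N v (act_tens (Delta_L L (f0 S v) mu nu u) xi (ket (f0 S v) la)))).
Proof.
split; split=> hyp.
(* Taking the exchange relation at [v] divided by [sqrth q] turns its vertex operator into Phi(v).
   Scaling both arguments by [sqrth q] then makes its R-matrix the one at [(sqrth q * u, v)] given
   by the comultiplication. *)
- have := for_generic_scaler (invr_neq0 (sqrth_neq0 q))
    (for_generic_and hyp hratio).
  move=> /for_generic_and /(_ (for_generic_scalel (sqrth_neq0 q) hL0)).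
  apply: for_generic_sub => u v u0 v0 [[rel ratio] act0] N mu nu xi.
  apply/funext => ka; rewrite hL1 // /act_ctens.
  have := rel N mu ka nu xi; rewrite mulVKf ?sqrth_neq0 // /Phi_comp => ->.
  apply: eq_fsbigr => x _; rewrite type_I_term //;
    last by move=> *; rewrite [u * _]mulrC act0.
  rewrite -(ratio _ (sqrth_neq0 q)) mulVKf ?sqrth_neq0 //.
  by rewrite [u * _]mulrC.
(* Conversely, the intertwining relation is taken at [sqrth q * v]; both arguments of its R-matrix
   carry [sqrth q], which cancels in the ratio. *)
- have := for_generic_and (for_generic_scaler (sqrth_neq0 q) hyp) hratio.
  move=> /for_generic_and /(_ (for_generic_scalel (sqrth_neq0 q)
    (for_generic_scaler (sqrth_neq0 q) hL0))).
  apply: for_generic_sub => u v u0 v0 [[rel ratio] act0] N mu nu mu'' xi.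
  rewrite -hL1 // /Phi_comp rel /act_ctens.
  apply: eq_fsbigr => x _; rewrite type_I_term //;
    last by move=> *; rewrite [u * _]mulrC act0.
  by rewrite [u * _]mulrC ratio ?sqrth_neq0.
(* In type II the second factor has gamma = 1, so both relations are compared at the same
   [(u, v)]. *)
- apply: for_generic_sub (for_generic_and hyp (for_generic_and hL0 hshift)).
  move=> u v u0 v0 [rel [act0 shift]] N mu nu la xi.
  by rewrite (type_II_sum hL1) // hL1 //; exact: rel.
- apply: for_generic_sub (for_generic_and hyp (for_generic_and hL0 hshift)).
  move=> u v u0 v0 [rel [act0 shift]] N mu nu la xi.
  by rewrite -(type_II_sum hL1) // -hL1 //; exact: rel.
Qed.
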